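(* Let $V$ be a finite set of voters and $C=\{c_1,c_2,c_3\}$. Let $F$ be a social welfare function on $V$ and $C$ satisfying CC (Condorcet cycle domain), MIIA, A (anonymity) and N (neutrality). Then $F$ is an unweighted Borda rule. If $F$ also satisfies P (Pareto), then $F$ is the positive unweighted Borda rule. Alternatively, if $F$ also satisfies PR (positive responsiveness), then $F$ is the positive unweighted Borda rule or the tie rule.
   Context: Setting. $\mathfrak{R}$ is the set of bijections $r:C\to\{0,1,2\}$ (rankings; a larger value means ranked higher); a ranking is also written as a list from best to worst, so $c_1c_2c_3$ is $c_i\mapsto 3-i$. $\mathfrak{R}_=$ is the set of weak orderings $\succ$ of $C$ (an equivalence relation of tying together with a total order of winning on the classes; $c_i\succ c_j$ means $c_i$ strictly beats $c_j$). A social welfare function (SWF) is a function $F:E\to\mathfrak{R}_=$ where $E\subset\mathfrak{R}^V$ is a set of elections. For $i\neq j$: $\pi_{i,j}(r)=r(c_i)-r(c_j)\in D_3=\{-2,-1,1,2\}$; for $e\in E$, $\pi_{i,j}(e):V\to D_3$ is $v\mapsto\pi_{i,j}(e(v))$; $A_{i,j}=\pi_{i,j}(E)$; for $\succ\in\mathfrak{R}_=$, $\pi_{i,j}(\succ)=W$ if $c_i\succ c_j$, $L$ if $c_j\succ c_i$, $T$ otherwise. Order: $W>T>L$. Promotion: for rankings $r_1,r_2$, $c_i\ne c_j$ and $c_m$ the third candidate, $(c_j,c_i)$ is promoted by $(r_2,r_1)$ if: (i) $r_1(c_m)>r_1(c_i)\Rightarrow r_2(c_m)>r_2(c_i)$;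 (ii) $r_1(c_j)>r_1(c_m)\Rightarrow r_2(c_j)>r_2(c_m)$; (iii) $r_1(c_j)>r_1(c_i)\Rightarrow r_2(c_j)>r_2(c_i)$. For elections, $(c_j,c_i)$ is promoted by $(e_2,e_1)$ if it is promoted by $(e_2(v),e_1(v))$ for every $v\in V$. Conditions on $F$: - CC: $E=\mathfrak{C}^V$ where $\mathfrak{C}=\{c_1c_2c_3,\ c_2c_3c_1,\ c_3c_1c_2\}$. - MIIA: for all $i\ne j$ there is $f_{i,j}:A_{i,j}\to\{W,T,L\}$ with $f_{i,j}(\pi_{i,j}(e))=\pi_{i,j}(F(e))$ for all $e\in E$. - A: $F(e)$ depends only on $\tau(e)\in\mathbb{R}_{\ge0}^{\mathfrak{R}}$, $\tau(e)(r)=|e^{-1}(r)|$. - N: for every permutation $\rho$ of $C$ and all $e\in E$ with $\rho\circ e\in E$, $F(\rho\circ e)=\rho(F(e))$. Here $(\rho\circ e)(v)=\rho(e(v))$ with $\rho(r)=r\circ\rho^{-1}$, and $\rho(\succ)$ is the weak ordering in which $\rho(c_i)$ beats $\rho(c_j)$ iff $c_i\succ c_j$. - P: if $\pi_{i,j}(e)(v)>0$ for all $v\in V$ then $\pi_{i,j}(F(e))=W$. - PR: whenever $(c_j,c_i)$ is promoted by $(e_2,e_1)$, $\pi_{i,j}(F(e_1))\ge\pi_{i,j}(F(e_2))$. Unweighted Borda rules: for a constant $w\in\mathbb{R}$, the SWF ranking candidates by the score $b_w(c,e)=w\sum_{v\in V}e(v)(c)$ ($c_i$ beats $c_j$ iff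 $b_w(c_i,e)>b_w(c_j,e)$). There are three: positive ($w=1$), negative ($w=-1$), and the tie rule ($w=0$), under which all candidates are always tied. *)

(* Defs.v *)
From mathcomp Require Import all_boot all_order all_fingroup all_algebra.
From mathcomp Require Import reals.

Set Implicit Arguments.
Unset Strict Implicit.
Unset Printing Implicit Defensive.

Import Order.TTheory GRing.Theory Num.Theory.
Local Open Scope ring_scope.

Definition cand : finType := 'I_3.
Definition c1 : cand := inord 0.
Definition c2 : cand := inord 1.
Definition c3 : cand := inord 2.

(* A ranking is a bijection from the candidates to {0, 1, 2}, 2 being the best
   value; as [cand] is ['I_3], such a bijection is a permutation of ['I_3]. *)
Definition ranking : finType := {perm cand}.

Definition listed (r : ranking) (a b c : cand) : bool :=
  [&& val (r a) == 2%N, val (r b) == 1%N & val (r c) == 0%N].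

Definition condorcet : {set ranking} :=
  [set r | [|| listed r c1 c2 c3, listed r c2 c3 c1 | listed r c3 c1 c2]].

(* [b] is the strict ("beats") part.  Ties are incomparable pairs; once they
   form an equivalence relation, a transitive irreflexive [b] is compatible with
   it and is a strict total order on its classes. *)
Definition tied_rel (b : rel cand) : rel cand :=
  [rel x y | ~~ b x y && ~~ b y x].

Definition is_weak_ordering (b : rel cand) : bool :=
  [&& [forall x, ~~ b x x],
      [forall x, forall y, forall z, b x y ==> (b y z ==> b x z)] &
      [forall x, forall y, forall z,
         tied_rel b x y ==> (tied_rel b y z ==> tied_rel b x z)]].

(* Stored as the set of pairs (winner, loser), so that equality of weak
   orderings is extensional. *)
Definition weak_ordering : Type :=
  {w : {set cand * cand} | is_weak_ordering [rel x y | (x, y) \in w]}.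

Definition beats (w : weak_ordering) : rel cand :=
  [rel x y | (x, y) \in val w].

Lemma is_weak_ordering_set (b : rel cand) :
  is_weak_ordering b ->
  is_weak_ordering [rel x y | (x, y) \in [set p : cand * cand | b p.1 p.2]].
Proof.
case/and3P => /forallP b_irr /forallP b_tr /forallP t_tr; apply/and3P; split.
- by apply/forallP => x; rewrite /= inE.
- apply/forallP => x; apply/forallP => y; apply/forallP => z; rewrite /= !inE.
  by have /forallP/(_ y)/forallP/(_ z) := b_tr x.
- apply/forallP => x; apply/forallP => y; apply/forallP => z.
  by rewrite /tied_rel /= !inE; have /forallP/(_ y)/forallP/(_ z) := t_tr x.
Qed.

Definition weak_ordering_of (b : rel cand) (hb : is_weak_ordering b) :
    weak_ordering :=
  exist _ [set p : cand * cand | b p.1 p.2] (is_weak_ordering_set hb).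

Lemma permute_weak_ordering_subproof (rho : {perm cand}) (w : weak_ordering) :
  is_weak_ordering [rel x y | beats w ((rho^-1)%g x) ((rho^-1)%g y)].
Proof.
have : is_weak_ordering (beats w) by exact: valP w.
case/and3P => /forallP b_irr /forallP b_tr /forallP t_tr.
apply/and3P; split.
- by apply/forallP => x; apply: b_irr.
- apply/forallP => x; apply/forallP => y; apply/forallP => z.
  by have /forallP/(_ ((rho^-1)%g y))/forallP/(_ ((rho^-1)%g z)) :=
    b_tr ((rho^-1)%g x).
- apply/forallP => x; apply/forallP => y; apply/forallP => z.
  by have /forallP/(_ ((rho^-1)%g y))/forallP/(_ ((rho^-1)%g z)) :=
    t_tr ((rho^-1)%g x).
Qed.

Definition permute_weak_ordering (rho : {perm cand}) (w : weak_ordering) :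
    weak_ordering :=
  weak_ordering_of (permute_weak_ordering_subproof rho w).

Lemma rank_by_subproof (R : realType) (s : cand -> R) :
  is_weak_ordering [rel x y | s y < s x].
Proof.
apply/and3P; split.
- by apply/forallP => x /=; rewrite ltxx.
- apply/forallP => x; apply/forallP => y; apply/forallP => z /=.
  by apply/implyP => yx; apply/implyP => zy; apply: lt_trans zy yx.
- apply/forallP => x; apply/forallP => y; apply/forallP => z /=.
  rewrite /tied_rel /= -!leNgt; apply/implyP => /andP[xy yx]; apply/implyP => /andP[yz zy].
  by rewrite (le_trans xy yz) (le_trans zy yx).
Qed.

Definition rank_by (R : realType) (s : cand -> R) : weak_ordering :=
  weak_ordering_of (rank_by_subproof s).

Definition election (V : finType) : finType := {ffun V -> ranking}.

Definition swf (V : finType) (E : {set election V}) : Type :=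
  {e : election V | e \in E} -> weak_ordering.

Inductive outcome : Set := W | T | L.

Definition outcome_level (o : outcome) : nat :=
  match o with W => 2 | T => 1 | L => 0 end.

Definition outcome_ge (o o' : outcome) : bool :=
  (outcome_level o' <= outcome_level o)%N.

Definition result (i j : cand) (w : weak_ordering) : outcome :=
  if beats w i j then W else if beats w j i then L else T.

Definition margin (i j : cand) (r : ranking) : int :=
  (val (r i))%:Z - (val (r j))%:Z.

Definition margins (V : finType) (i j : cand) (e : election V) :
    {ffun V -> int} :=
  [ffun v => margin i j (e v)].

Definition attained_margins (V : finType) (E : {set election V}) (i j : cand) :
    seq {ffun V -> int} :=
  [seq margins i j e | e in E].

Definition tally (V : finType) (e : election V) : {ffun ranking -> nat} :=
  [ffun r => #|[set v | e v == r]|].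

(* Permutations compose left to right: [rho^-1 * r] maps [c] to
   [r (rho^-1 c)]. *)
Definition permute_ranking (rho : {perm cand}) (r : ranking) : ranking :=
  (rho^-1 * r)%g.

Definition permute_election (V : finType) (rho : {perm cand}) (e : election V) :
    election V :=
  [ffun v => permute_ranking rho (e v)].

(* [(j, i)] is promoted by [(r2, r1)]; used only for [i != j], when the third
   candidate [m] is unique. *)
Definition promoted (j i : cand) (r2 r1 : ranking) : Prop :=
  forall m : cand, m != i -> m != j ->
  [/\ (val (r1 m) > val (r1 i))%N -> (val (r2 m) > val (r2 i))%N,
      (val (r1 j) > val (r1 m))%N -> (val (r2 j) > val (r2 m))%N &
      (val (r1 j) > val (r1 i))%N -> (val (r2 j) > val (r2 i))%N].

Definition promoted_election (V : finType) (j i : cand) (e2 e1 : election V) :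
    Prop :=
  forall v : V, promoted j i (e2 v) (e1 v).

Definition CC (V : finType) (E : {set election V}) : Prop :=
  E = [set e : election V | [forall v, e v \in condorcet]].

Definition MIIA (V : finType) (E : {set election V}) (F : swf E) : Prop :=
  forall i j : cand, i != j ->
  exists f : {a : {ffun V -> int} | a \in attained_margins E i j} -> outcome,
  forall e a, val a = margins i j (val e) -> f a = result i j (F e).

Definition anonymous (V : finType) (E : {set election V}) (F : swf E) : Prop :=
  forall e e', tally (val e) = tally (val e') -> F e = F e'.

Definition neutral (V : finType) (E : {set election V}) (F : swf E) : Prop :=
  forall (rho : {perm cand}) e e',
  val e' = permute_election rho (val e) ->
  F e' = permute_weak_ordering rho (F e).

Definition pareto (V : finType) (E : {set election V}) (F : swf E) : Prop :=
  forall (i j : cand) e, i != j ->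
  (forall v : V, 0 < margins i j (val e) v) -> result i j (F e) = W.

Definition positively_responsive (V : finType) (E : {set election V})
    (F : swf E) : Prop :=
  forall (i j : cand) e1 e2, i != j ->
  promoted_election j i (val e2) (val e1) ->
  outcome_ge (result i j (F e1)) (result i j (F e2)).

Definition borda_score (R : realType) (V : finType) (w : R) (c : cand)
    (e : election V) : R :=
  w * \sum_(v : V) (val (e v c))%:R.

Definition unweighted_borda (R : realType) (V : finType)
    (E : {set election V}) (w : R) : swf E :=
  fun e => rank_by (fun c => borda_score w c (val e)).

Definition is_unweighted_borda (R : realType) (V : finType)
    (E : {set election V}) (F : swf E) : Prop :=
  exists w : R, F =1 unweighted_borda w.

Definition is_positive_borda (R : realType) (V : finType)
    (E : {set election V}) (F : swf E) : Prop :=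
  F =1 unweighted_borda (1 : R).

Definition is_tie_rule (R : realType) (V : finType)
    (E : {set election V}) (F : swf E) : Prop :=
  F =1 unweighted_borda (0 : R).

(* Main.v *)
Require Import Defs.
From mathcomp Require Import all_boot all_order all_fingroup all_algebra.
From mathcomp Require Import reals.
From mathcomp Require Import zify lra.

Set Implicit Arguments.
Unset Strict Implicit.
Unset Printing Implicit Defensive.

Import Order.TTheory GRing.Theory Num.Theory.
Local Open Scope ring_scope.

(** Between [i] and [i + 1] (indices modulo 3) a voter's margin is [-2] if that
voter ranks [i] last and [1] otherwise.  By MIIA, anonymity and neutrality the
result on this pair is therefore a sign [s k], with [s] independent of [i] and
[k] the number of voters ranking [i] last.  The three counts of an election can
be any [a + b + c = n], and a weak ordering forces [s a, s b, s c] to be all zero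
or to contain both signs.  Hence [s k] has the sign of [s 0 * (n - 3 k)], and
[n - 3 k] is the Borda score of [i] minus that of [i + 1]. *)

(** * Integer sequences with balanced triples *)

Definition balanced (x y z : int) : Prop :=
  (x = 0 /\ y = 0 /\ z = 0) \/
  ((0 < x \/ 0 < y \/ 0 < z) /\ (x < 0 \/ y < 0 \/ z < 0)).

Lemma balancedN (x y z : int) : balanced x y z -> balanced (- x) (- y) (- z).
Proof. rewrite /balanced; lia. Qed.

Section BalancedSigns.
Variables (n : nat) (s : nat -> int).
Hypothesis sbal : forall a b c, (a + b + c = n)%N -> balanced (s a) (s b) (s c).

(** The triples [(a, b, n - a - b)] and [(0, a + b, n - a - b)] show that a sign shared by [s a] and
    [s b] passes to [s (a + b)]. So all signs on [1 .. n] agree with that of [s 1], while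
    [(0, 0, n)] forces [s n = 0]. *)
Lemma balanced_eq0 : s 0 = 0 -> forall k, (k <= n)%N -> s k = 0.
Proof.
move=> s0.
have add a b : (a + b <= n)%N -> Num.sg (s a) = Num.sg (s b) ->
    Num.sg (s (a + b)%N) = Num.sg (s a).
  move=> abn; have := sbal (a := a) (b := b) (c := n - (a + b)) ltac:(lia).
  have := sbal (a := 0) (b := a + b) (c := n - (a + b)) ltac:(lia).
  rewrite s0 /balanced; case: sgrP; case: sgrP; case: sgrP; lia.
have const k : (0 < k <= n)%N -> Num.sg (s k) = Num.sg (s 1).
  elim: k => [//|[//|k] IHk] kn.
  by rewrite -addn1 add ?IHk //; lia.
move=> k kn; have [->//|k0] := posnP k.
have := sbal (a := 0) (b := 0) (c := n) erefl.
have := const n ltac:(lia); have := const k ltac:(lia).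
rewrite s0 /balanced; case: sgrP; case: sgrP; case: sgrP; lia.
Qed.

(* At a least counterexample [k], [s < 0] on [k+1 .. 2k], and hence on all of
   [k+1 .. n] since [s a <= 0] and [s b < 0] give [s (a + b) < 0]; but
   [s (n - 2k)] and [s k] are opposite. *)
Lemma balanced_gt0_small : 0 < s 0 -> forall k, (3 * k < n)%N -> 0 < s k.
Proof.
move=> s0; elim/ltn_ind => k IHk k3n; apply/negP => /negP sk.
have k0 : (0 < k)%N by case: (posnP k) => // k0; rewrite k0 s0 in sk.
have kkn := sbal (a := k) (b := k) (c := n - 2 * k) ltac:(lia).
(* [s (2k - y)] is positive by minimality of [k], and [s (n - 2k)] is non-negative by [kkn], so the
   third member [s y] must be negative. *)
have mid y : (k < y <= 2 * k)%N -> s y < 0.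
  move=> ky; have := IHk (2 * k - y)%N ltac:(lia) ltac:(lia).
  have := sbal (a := n - 2 * k) (b := 2 * k - y) (c := y) ltac:(lia).
  move: kkn; rewrite /balanced; lia.
have large y : (k < y <= n)%N -> s y < 0.
  elim/ltn_ind: y => y IHy ky.
  have [yk|yk] := leqP y (2 * k); first by apply: mid; lia.
  have := IHy (y - k)%N ltac:(lia) ltac:(lia).
  have := sbal (a := k) (b := y - k) (c := n - y) ltac:(lia).
  have := sbal (a := 0) (b := y) (c := n - y) ltac:(lia).
  rewrite /balanced; lia.
have := large (n - 2 * k)%N ltac:(lia).
move: kkn; rewrite /balanced; lia.
Qed.

Lemma balanced_sg_gt0 : 0 < s 0 ->
  forall k, (k <= n)%N -> Num.sg (s k) = Num.sg (n%:Z - (3 * k)%:Z).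
Proof.
move=> s0 k kn; have small := balanced_gt0_small s0.
have third x : (3 * x = n)%N -> s x = 0.
  move=> xn; have := sbal (a := x) (b := x) (c := x) ltac:(lia).
  rewrite /balanced; lia.
case: (ltngtP (3 * k)%N n) => [lt|gt|eq].
- by rewrite !gtr0_sg ?small //; lia.
- rewrite !ltr0_sg //; first by lia.
  (* Split [n - k] into halves. The lower half lies below [n / 3], so its sign is positive. The
     upper half is at most [n / 3], with sign positive or zero, or by parity equals [k]; either way
     balance makes [s k] negative. *)
  pose x := ((n - k) %/ 2)%N; have xn := small x ltac:(lia).
  have := sbal (a := x) (b := n - k - x) (c := k) ltac:(lia).
  have : 0 < s (n - k - x)%N \/ s (n - k - x)%N = 0 \/ (n - k - x = k)%N.
    case: (ltngtP (3 * (n - k - x))%N n) => [/small|?|/third]; first by left.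
    - by right; right; lia.
    - by move=> ?; right; left.
  rewrite /balanced; case=> [|[|->]]; lia.
- by rewrite third // eq subrr.
Qed.

End BalancedSigns.

Lemma balanced_sg (n : nat) (s : nat -> int) :
  (forall a b c, (a + b + c = n)%N -> balanced (s a) (s b) (s c)) ->
  forall k, (k <= n)%N -> Num.sg (s k) = Num.sg (s 0) * Num.sg (n%:Z - (3 * k)%:Z).
Proof.
move=> sbal k kn; case: (ltrgtP (s 0) 0) => [s0|s0|s0].
- have Nbal a b c (abc : (a + b + c = n)%N) := balancedN (sbal _ _ _ abc).
  have := balanced_sg_gt0 Nbal; rewrite oppr_gt0 => /(_ s0 k kn).
  by rewrite sgrN (ltr0_sg s0) mulN1r => <-; rewrite opprK.
- by rewrite (gtr0_sg s0) mul1r (balanced_sg_gt0 sbal s0).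
- by rewrite (balanced_eq0 sbal s0 kn) s0 sgr0 mul0r.
Qed.

(** * Weak orderings read off their cyclic comparisons *)

Lemma ord3_ind (P : 'I_3 -> Prop) :
  P 0 -> P 1 -> P (1 + 1) -> forall i, P i.
Proof.
move=> P0 P1 P2 [[|[|[|//]]] lti].
- by rewrite (_ : Ordinal lti = 0) //; apply: val_inj.
- by rewrite (_ : Ordinal lti = 1) //; apply: val_inj.
- by rewrite (_ : Ordinal lti = 1 + 1) //; apply: val_inj.
Qed.

Lemma beats_irr (w : weak_ordering) x : beats w x x = false.
Proof. by case/and3P: (valP w) => /forallP/(_ x)/negbTE. Qed.

Lemma beats_trans (w : weak_ordering) x y z :
  beats w x y ==> (beats w y z ==> beats w x z).
Proof. by case/and3P: (valP w) => _ /forallP/(_ x)/forallP/(_ y)/forallP/(_ z). Qed.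

Lemma tied_trans (w : weak_ordering) x y z :
  tied_rel (beats w) x y ==>
  (tied_rel (beats w) y z ==> tied_rel (beats w) x z).
Proof. by case/and3P: (valP w) => _ _ /forallP/(_ x)/forallP/(_ y)/forallP/(_ z). Qed.

Lemma beats_asym (w : weak_ordering) x y : beats w x y ==> ~~ beats w y x.
Proof. by have := beats_trans w x y x; rewrite beats_irr implybF. Qed.

Definition outcome_sign (o : outcome) : int :=
  match o with W => 1 | T => 0 | L => -1 end.

Lemma outcome_sign_inj : injective outcome_sign.
Proof. by case; case. Qed.

Lemma outcome_signK o : Num.sg (outcome_sign o) = outcome_sign o.
Proof. by case: o. Qed.

(** Addition in ['I_3] is modulo 3, so [i + 1] is the successor of [i] on a 3-cycle. *)
Definition cyclic_sign (w : weak_ordering) (i : 'I_3) : int :=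
  outcome_sign (result i (i + 1) w).

(** A win without any loss around the cycle would make a candidate beat itself, and dually for a
    loss. The proof checks all values of the six comparisons between distinct candidates. *)
Lemma cyclic_sign_balanced w :
  balanced (cyclic_sign w 0) (cyclic_sign w 1) (cyclic_sign w (1 + 1)).
Proof.
rewrite /cyclic_sign /result (_ : 0 + 1 = 1 :> 'I_3); last exact: val_inj.
rewrite (_ : 1 + 1 + 1 = 0 :> 'I_3); last exact: val_inj.
move: (beats_trans w 0 1 (1 + 1)) (beats_trans w 1 (1 + 1) 0)
  (beats_trans w (1 + 1) 0 1) (beats_trans w 1 0 (1 + 1))
  (beats_trans w 0 (1 + 1) 1) (beats_trans w (1 + 1) 1 0).
move: (tied_trans w 0 1 (1 + 1)) (tied_trans w 1 (1 + 1) 0)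
  (tied_trans w (1 + 1) 0 1).
move: (beats_asym w 0 1) (beats_asym w 1 (1 + 1)) (beats_asym w (1 + 1) 0).
move: (beats w) => b; rewrite /tied_rel /=.
move: (b 0 1) (b 1 0) (b 1 (1 + 1)) (b (1 + 1) 1) (b 0 (1 + 1)) (b (1 + 1) 0).
do 6!case; move=> //= *; first [by left | right; split];
  first [by left | by right; left | by right; right].
Qed.

Lemma beats_cyclic_sign w (i : 'I_3) :
  beats w i (i + 1) = (cyclic_sign w i == 1) /\
  beats w (i + 1) i = (cyclic_sign w i == -1).
Proof.
rewrite /cyclic_sign /result; case: ifP => [/(implyP (beats_asym w _ _))/negbTE->//|_].
by case: ifP.
Qed.

(** Distinct residues modulo 3 are cyclic neighbours, so the cyclic comparisons cover every pair. *)
Lemma weak_ordering_eq w w' : cyclic_sign w =1 cyclic_sign w' -> w = w'.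
Proof.
move=> ww'; apply: val_inj; apply/setP => -[x y].
rewrite -[LHS]/(beats w x y) -[RHS]/(beats w' x y).
have [->|xy] := eqVneq x y; first by rewrite !beats_irr.
have /orP[/eqP->|/eqP->] : (y == x + 1 :> 'I_3) || (x == y + 1 :> 'I_3).
  by move: x y xy; do 2!elim/ord3_ind=> //.
- by rewrite !(beats_cyclic_sign _ x).1 ww'.
- by rewrite !(beats_cyclic_sign _ y).2 ww'.
Qed.

Lemma cyclic_sign_rank_by (R : realType) (sc : cand -> R) (i : 'I_3) :
  (cyclic_sign (rank_by sc) i)%:~R = Num.sg (sc i - sc (i + 1)).
Proof.
rewrite /cyclic_sign /result /beats /= !inE /=.
by case: ltrgtP => h; case: sgrP => //; lra.
Qed.

Lemma result_permute (rho : {perm cand}) w i j :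
  result (rho i) (rho j) (permute_weak_ordering rho w) = result i j w.
Proof. by rewrite /result /beats /= !inE /= !permK. Qed.

(** * Condorcet rankings and their rotations *)

(* The cyclic rankings are the maps [x |-> t - x] modulo 3; [t] is ranked last. *)
Definition cycle_ranking (t : 'I_3) : ranking := perm (@subrI _ t).

Definition rotation (d : 'I_3) : {perm cand} := perm (@addrI _ d).

Lemma permute_cycle_ranking d t :
  permute_ranking (rotation d) (cycle_ranking t) = cycle_ranking (d + t).
Proof.
apply/permP => x; rewrite permM -[x in RHS](permKV (rotation d)).
move: ((rotation d)^-1 x)%g => y; rewrite !permE.
by rewrite opprD addrACA subrr add0r.
Qed.

Lemma cycle_ranking_inj : injective cycle_ranking.
Proof.
move=> t u /permP/(_ 0); rewrite !permE !subr0; exact.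
Qed.

Lemma margin_cycle_ranking i t :
  margin i (i + 1) (cycle_ranking t) = 1 - 3 * (t == i)%:Z.
Proof. by rewrite /margin !permE; move: i t; do 2!elim/ord3_ind. Qed.

Lemma condorcetP r : reflect (exists t, r = cycle_ranking t) (r \in condorcet).
Proof.
have E1 : c1 = 0 by apply: val_inj; rewrite /= inordK.
have E2 : c2 = 1 by apply: val_inj; rewrite /= inordK.
have E3 : c3 = 1 + 1 by apply: val_inj; rewrite /= inordK.
rewrite inE E1 E2 E3 /listed; apply: (iffP idP) => [|[t ->]]; last first.
  by rewrite !permE; move: t; elim/ord3_ind.
(* The witnesses are the last candidates of the three lists in turn. *)
by case/or3P=> /and3P[/eqP e0 /eqP e1 /eqP e2]; [exists (1 + 1)|exists 0|exists 1];
  apply/permP; elim/ord3_ind; rewrite permE; apply: val_inj; rewrite ?e0 ?e1 ?e2.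
Qed.

Lemma exists_subset_card (U : finType) (S : {set U}) k :
  (k <= #|S|)%N -> exists2 B : {set U}, B \subset S & #|B| = k.
Proof.
move=> kS; exists [set x in take k (enum S)].
  by apply/subsetP => x; rewrite inE => /mem_take; rewrite mem_enum.
by rewrite cardsE (card_uniqP _) ?take_uniq ?enum_uniq // size_takel -?cardE.
Qed.

(** * Elections on the Condorcet domain *)

Section CycleElections.
Variable V : finType.
Implicit Type tau : {ffun V -> 'I_3}.

Definition cycle_domain : {set election V} :=
  [set e : election V | [forall v, e v \in condorcet]].

Lemma cycle_election_subproof tau :
  [ffun v => cycle_ranking (tau v)] \in cycle_domain.
Proof.
rewrite inE; apply/forallP => v; rewrite ffunE.
by apply/condorcetP; exists (tau v).
Qed.

(** [tau] gives each voter's last candidate, which determines the whole Condorcet ranking. *)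
Definition cycle_election tau : {e : election V | e \in cycle_domain} :=
  exist (fun e => e \in cycle_domain) _ (cycle_election_subproof tau).

Lemma cycle_electionE tau v :
  (val (cycle_election tau)) v = cycle_ranking (tau v).
Proof. by rewrite ffunE. Qed.

Lemma cycle_election_surj e : exists tau, e = cycle_election tau.
Proof.
case: e => e he; have := he; rewrite inE => /forallP e_cond.
have [tau tauP] : exists tau, forall v, (e : election V) v = cycle_ranking (tau v).
  have ex v : exists t, e v == cycle_ranking t.
    by have [t ->] := condorcetP _ (e_cond v); exists t.
  by exists [ffun v => xchoose (ex v)] => v; rewrite ffunE; apply/eqP/(xchooseP (ex v)).
by exists tau; apply: val_inj; apply/ffunP => v; rewrite cycle_electionE.
Qed.

Definition bottom_count tau (i : 'I_3) : nat := #|[set v | tau v == i]|.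

Lemma bottom_count_le tau i : (bottom_count tau i <= #|V|)%N.
Proof. exact: max_card. Qed.

Lemma bottom_count_const i j :
  bottom_count [ffun=> i] j = if i == j then #|V| else 0%N.
Proof.
rewrite /bottom_count; case: ifP => ij.
  by rewrite -cardsT; apply: eq_card => v; rewrite !inE ffunE.
by apply: eq_card0 => v; rewrite !inE ffunE.
Qed.

(** This supplies every triple that the arithmetic of balanced sequences calls for. *)
Lemma exists_bottom_counts a b c : (a + b + c = #|V|)%N ->
  exists tau, [/\ bottom_count tau 0 = a, bottom_count tau 1 = b
                & bottom_count tau (1 + 1) = c].
Proof.
move=> abc; have [|A _ cA] := @exists_subset_card V setT a.
  by rewrite cardsT; lia.
have [|B BA cB] := @exists_subset_card V (~: A) b; first by rewrite cardsCs setCK; lia.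
exists [ffun v => if v \in A then 0 else if v \in B then 1 else 1 + 1].
have notA v : v \in B -> (v \in A) = false.
  by move=> /(subsetP BA); rewrite inE => /negbTE.
split; rewrite /bottom_count.
- by rewrite -cA; apply: eq_card => v; rewrite !inE ffunE; case: ifP => // _; case: ifP.
- rewrite -cB; apply: eq_card => v; rewrite !inE ffunE.
  by case: ifPn => [vA|_]; [apply/esym; apply: contraTF vA => /notA->|case: ifP].
- have -> : c = #|~: (A :|: B)|.
    rewrite cardsCs setCK cardsU -setIC (eqP (_ : B :&: A == set0)) ?cards0; first lia.
    by rewrite setI_eq0 disjoints_subset.
  apply: eq_card => v; rewrite !inE ffunE.
  by case: ifP => // _; case: ifP.
Qed.

Lemma tally_cycle_election tau tau' : bottom_count tau =1 bottom_count tau' ->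
  Defs.tally (val (cycle_election tau)) = Defs.tally (val (cycle_election tau')).
Proof.
move=> tt'; apply/ffunP => r; rewrite !ffunE.
have [/condorcetP[t ->]|rC] := boolP (r \in condorcet).
  have cnt u : #|[set v | val (cycle_election u) v == cycle_ranking t]| =
      bottom_count u t.
    by apply: eq_card => v; rewrite !inE cycle_electionE (inj_eq cycle_ranking_inj).
  by rewrite !cnt.
(* A ranking outside the Condorcet cycle has tally zero in both elections. *)
by rewrite !eq_card0 // => v; rewrite !inE cycle_electionE; apply: contraNF rC => /eqP<-;
  apply/condorcetP; eexists.
Qed.

Lemma rotate_cycle_election d tau :
  val (cycle_election [ffun v => d + tau v]) =
  permute_election (rotation d) (val (cycle_election tau)).
Proof.
apply/ffunP => v.
by rewrite cycle_electionE [RHS]ffunE cycle_electionE permute_cycle_ranking ffunE.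
Qed.

Lemma bottom_count_rotate d tau i :
  bottom_count [ffun v => d + tau v] (d + i) = bottom_count tau i.
Proof. by apply: eq_card => v; rewrite !inE ffunE (inj_eq (addrI d)). Qed.

Lemma margins_cycle_election i tau v :
  margins i (i + 1) (val (cycle_election tau)) v = 1 - 3 * (tau v == i)%:Z.
Proof. by rewrite ffunE cycle_electionE margin_cycle_ranking. Qed.

Lemma sum_margins_cycle_election i tau :
  \sum_v margins i (i + 1) (val (cycle_election tau)) v =
  #|V|%:Z - (3 * bottom_count tau i)%:Z.
Proof.
under eq_bigr => v _ do rewrite margins_cycle_election.
rewrite sumrB -mulr_sumr sumr_const PoszM; congr (_ - _ * _).
  by rewrite -natz; congr (1 *+ _); apply: eq_card.
rewrite /bottom_count -sum1_card [in RHS]big_mkcond /=.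
rewrite (big_morph Posz PoszD erefl); apply: eq_bigr => v _.
by rewrite inE; case: eqP.
Qed.

Lemma borda_score_sub (R : realType) (w : R) (i j : cand) (e : election V) :
  borda_score w i e - borda_score w j e = w * (\sum_v margins i j e v)%:~R.
Proof.
rewrite /borda_score -mulrBr -sumrB rmorph_sum; congr (_ * _).
by apply: eq_bigr => v _; rewrite ffunE /margin rmorphB.
Qed.

(** * From the axioms to a sign depending on the bottom count alone *)

Section Rule.
Variable F : swf cycle_domain.
Hypotheses (hMIIA : MIIA F) (hA : anonymous F) (hN : neutral F).

(** A voter's margin between [i] and [i + 1] reveals only whether [i] is last, so MIIA sees just
    that set of voters. *)
Lemma cyclic_sign_same_bottom i tau tau' :
  (forall v, (tau v == i) = (tau' v == i)) ->
  cyclic_sign (F (cycle_election tau)) i = cyclic_sign (F (cycle_election tau')) i.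
Proof.
move=> tt'; have ii1 : i != i + 1 by move: i {tt'}; elim/ord3_ind.
have [f fP] := hMIIA ii1.
pose a := margins i (i + 1) (val (cycle_election tau)).
have aA : a \in attained_margins cycle_domain i (i + 1).
  exact: image_f (valP (cycle_election tau)).
pose a' := exist (fun a => a \in attained_margins cycle_domain i (i + 1)) a aA.
rewrite /cyclic_sign -(fP _ a') // -(fP _ a') //=.
by apply/ffunP => v; rewrite !margins_cycle_election tt'.
Qed.

Lemma cyclic_sign_bottom_count_same i tau tau' :
  bottom_count tau i = bottom_count tau' i ->
  cyclic_sign (F (cycle_election tau)) i = cyclic_sign (F (cycle_election tau')) i.
Proof.
(* Without changing the set of voters ranking [i] last, make all the others rank
   [i + 1] last: the tally is then determined by the count. *)
move=> tt'; pose norm (u : {ffun V -> 'I_3}) : {ffun V -> 'I_3} :=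
  [ffun v => if u v == i then i else i + 1].
have i1i : (i + 1 == i) = false by move: i {norm tt'}; elim/ord3_ind.
have normP (u : {ffun V -> 'I_3}) v : (u v == i) = (norm u v == i).
  by rewrite ffunE; case: ifP; rewrite ?eqxx ?i1i.
rewrite (cyclic_sign_same_bottom (normP tau)) (cyclic_sign_same_bottom (normP tau')).
congr (cyclic_sign _ i); apply: hA; apply: tally_cycle_election => j.
have cnt u : bottom_count (norm u) j =
    if i == j then bottom_count u i
    else if i + 1 == j then (#|V| - bottom_count u i)%N else 0%N.
  rewrite /bottom_count; case: (eqVneq i j) => [<-|ij].
    by apply: eq_card => v; rewrite !inE -normP.
  case: eqP => [<-|/eqP i1j]; last first.
    by apply: eq_card0 => v; rewrite !inE ffunE; case: ifP => _; apply/negbTE.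
  rewrite cardsCs; congr (_ - _)%N; apply: eq_card => v; rewrite !inE ffunE.
  by case: ifP => _; rewrite ?eqxx // eq_sym i1i.
by rewrite !cnt tt'.
Qed.

(** Rotation by [i - j] carries the pair [j], [j + 1] to [i], [i + 1]; neutrality then reduces to a
    single pair. *)
Lemma cyclic_sign_bottom_count i j tau tau' :
  bottom_count tau i = bottom_count tau' j ->
  cyclic_sign (F (cycle_election tau)) i = cyclic_sign (F (cycle_election tau')) j.
Proof.
move=> tt'; rewrite (@cyclic_sign_bottom_count_same _ _ [ffun v => i - j + tau' v]).
  rewrite /cyclic_sign (hN (rotate_cycle_election (i - j) tau')).
  have rot x : rotation (i - j) (j + x) = i + x by rewrite permE addrA subrK.
  have rot0 : rotation (i - j) j = i by rewrite permE subrK.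
  by rewrite -[in RHS](result_permute (rotation (i - j))) rot rot0.
by rewrite tt' -(bottom_count_rotate (i - j)) subrK.
Qed.

Lemma exists_bottom_sign : exists s : nat -> int, forall i tau,
  cyclic_sign (F (cycle_election tau)) i = s (bottom_count tau i).
Proof.
(* Counts that no election attains get the default 0. Rotating by [- i] shows that a count attained
   at [i] is attained at candidate 0. *)
exists (fun k => if [pick tau | bottom_count tau 0 == k] is Some tau
                 then cyclic_sign (F (cycle_election tau)) 0 else 0) => i tau.
case: pickP => [u /eqP|/(_ [ffun v => - i + tau v])].
  by move/esym/cyclic_sign_bottom_count.
by rewrite -(bottom_count_rotate (- i) tau i) addNr eqxx.
Qed.

Lemma bottom_sign_sg (s : nat -> int) :
  (forall i tau, cyclic_sign (F (cycle_election tau)) i = s (bottom_count tau i)) ->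
  forall k, (k <= #|V|)%N -> Num.sg (s k) = Num.sg (s 0) * Num.sg (#|V|%:Z - (3 * k)%:Z).
Proof.
move=> sP; apply: balanced_sg => a b c /exists_bottom_counts[tau [<- <- <-]].
by rewrite -!sP; apply: cyclic_sign_balanced.
Qed.

(** The weight is the outcome for a candidate nobody ranks last against its successor: 1, 0 and -1
    give the positive, tie and negative rules. *)
Lemma bottom_sign_borda (R : realType) (s : nat -> int) :
  (forall i tau, cyclic_sign (F (cycle_election tau)) i = s (bottom_count tau i)) ->
  F =1 unweighted_borda ((Num.sg (s 0))%:~R : R).
Proof.
move=> sP e; have [tau ->] := cycle_election_surj e.
apply: weak_ordering_eq => i; apply: (@intr_inj R).
rewrite cyclic_sign_rank_by borda_score_sub sum_margins_cycle_election -intrM -intr_sg.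
rewrite sgrM sgr_id -(bottom_sign_sg sP) ?bottom_count_le // -sP.
by rewrite /cyclic_sign outcome_signK.
Qed.

End Rule.
End CycleElections.

(** * The classification, and the effect of Pareto and positive responsiveness *)

Theorem mainTheorem3 (R : realType) (V : finType) (E : {set election V})
    (F : swf E) (hCC : CC E) (hMIIA : MIIA F) (hA : anonymous F)
    (hN : neutral F) :
  is_unweighted_borda R F /\
  (pareto F -> is_positive_borda R F) /\
  (positively_responsive F -> is_positive_borda R F \/ is_tie_rule R F).
Proof.
rewrite /CC in hCC; subst E.
have [s sP] := exists_bottom_sign hMIIA hA hN.
have borda := bottom_sign_borda R sP.
(* If all voters rank 1 last, nobody ranks 0 last and everyone prefers 0 to 1; Pareto will be
   applied to this election. *)
have s0 : cyclic_sign (F (cycle_election [ffun=> 1])) 0 = s 0.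
  by rewrite sP bottom_count_const.
split; first by exists (Num.sg (s 0))%:~R.
split=> [hP|hPR].
  have s1 : s 0 = 1.
    rewrite -s0 /cyclic_sign hP // => v.
    by rewrite margins_cycle_election ffunE.
  by move: borda; rewrite s1.
have sV : cyclic_sign (F (cycle_election [ffun=> 0])) 0 = s #|V|.
  by rewrite sP bottom_count_const.
(* Passing from everyone ranking 1 last to everyone ranking 0 last promotes 1 over 0, so positive
   responsiveness compares [s 0] with [s #|V|]. *)
have prom : @promoted_election V (0 + 1) 0
    (val (cycle_election [ffun=> 0])) (val (cycle_election [ffun=> 1])).
  by move=> v m; rewrite !cycle_electionE !ffunE !permE; move: m; elim/ord3_ind.
have sg_le : Num.sg (s #|V|) <= Num.sg (s 0).
  have := hPR 0 (0 + 1) (cycle_election [ffun=> 1]) (cycle_election [ffun=> 0]) isT prom.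
  by rewrite -s0 -sV /cyclic_sign; case: result; case: result.
(* At [k = #|V|] the factor [#|V| - 3 #|V|] is negative if there are voters, so [s #|V|] and [s 0]
   have opposite signs and [s 0] cannot be negative. Without voters the formula gives [s 0 = 0], the
   tie rule. *)
have := bottom_sign_sg sP (leqnn _); have [V0|V_gt0] := posnP #|V|.
  by rewrite V0 muln0 subrr sgr0 mulr0 => s00; right; move: borda; rewrite s00.
rewrite [Num.sg (_ - _)]ltr0_sg; last by lia.
case: (sgrP (s 0)) sg_le borda => [_|_|_]; [by right|by left|lia].
Qed.
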